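(* Let $n=\mu s-1$ with integers $\mu\ge1$, $s\ge2$, and let $\omega\in\mathbb R$. Let $G_n(\omega,\mu;z)=g_0+g_1z+\dots+g_nz^n$, $g_k=g_k(\omega)$, be the producing polynomial. Then $$g_{\mu k-1}=g_{\mu-1}\,r_{k-1}(\omega),\qquad k=1,\dots,s,$$ all the remaining coefficients are zero, and $$G_n(\omega,\mu;z)=g_{\mu-1}(\omega)\,z^{\mu-1}\,\mathcal R_{s-1}(\omega;z^\mu).$$
   Context: The producing polynomial $G_n(\omega,\mu;z)$ ($1\le\mu\le n$) is the determinant of the $(n+1)\times(n+1)$ matrix whose first row is $(1,z,z^2,\dots,z^n)$ and whose $j$-th row, $2\le j\le n+1$, is $(\sigma_{j-1-n},\sigma_{j-n},\dots,\sigma_{j-1})$, where $\sigma_0=\omega$, $\sigma_{\mu}=\sigma_{-\mu}=1$ and $\sigma_k=0$ for $k\ne0,\pm\mu$. The polynomials $r_k(\omega)$ are defined by $r_{-1}=0$, $r_0=1$, $r_k(\omega)+\omega r_{k-1}(\omega)+r_{k-2}(\omega)=0$ for $k\ge1$, and $\mathcal R_{s-1}(\omega;t)=r_0(\omega)+r_1(\omega)t+\dots+r_{s-1}(\omega)t^{s-1}$. *)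

(* Defs.v *)
From HB Require Import structures.
From mathcomp Require Import all_boot all_order all_algebra.

Set Implicit Arguments.
Unset Strict Implicit.
Unset Printing Implicit Defensive.

Import GRing.Theory.
Local Open Scope ring_scope.

Section ProducingPolynomial.

Variable R : comNzRingType.

(* The generating sequence is indexed by all integers; mu > 0 is intended. *)
Definition sigma (omega : R) (mu : nat) (k : int) : R :=
  if k == 0 then omega else if `|k|%N == mu then 1 else 0.

(* Rows and columns are numbered from 0 here, so the entry in row i > 0 and
   column j is sigma_{i + j - n}: row i reads sigma_{i-n}, ..., sigma_i. *)
Definition producing_matrix (omega : R) (mu n : nat) : 'M[{poly R}]_n.+1 :=
  \matrix_(i, j)
    if i == 0 then 'X^j
    else (sigma omega mu (i%:Z + j%:Z - n%:Z))%:P.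

(* The variable z is the polynomial indeterminate 'X. *)
Definition producing_poly (n : nat) (omega : R) (mu : nat) : {poly R} :=
  \det (producing_matrix omega mu n).

(* The sequence r_{-1}, r_0, r_1, ... with its index shifted by one:
   rshift k is r_{k-1}, a polynomial in the indeterminate omega = 'X. *)
Fixpoint rshift (k : nat) : {poly R} :=
  match k with
  | 0 => 0
  | k1.+1 => match k1 with
             | 0 => 1
             | k2.+1 => - ('X * rshift k1) - rshift k2
             end
  end.

Definition rpoly (k : nat) : {poly R} := rshift k.+1.

Lemma rpoly0 : rpoly 0 = 1.
Proof. by []. Qed.

(* The recurrence at k >= 1, with r_{k-2} = rshift (k - 1). *)
Lemma rpoly_rec (k : nat) : (0 < k)%N ->
  rpoly k + 'X * rpoly (k - 1) + rshift (k - 1) = 0.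
Proof.
case: k => // k _; rewrite /rpoly subn1 /=.
by rewrite addrAC subrK addNr.
Qed.

(* The polynomial in t = 'X with coefficients r_0(omega), ..., r_m(omega). *)
Definition rsum (m : nat) (omega : R) : {poly R} :=
  \poly_(k < m.+1) (rpoly k).[omega].

End ProducingPolynomial.

(* Main.v *)
Require Import Defs.
From mathcomp Require Import all_boot all_order all_algebra.
From mathcomp Require Import reals zify.
Import GRing.Theory.
Local Open Scope ring_scope.

(** The coefficients of [G] are the cofactors of the first row of the producing
    matrix, hence expanding along that row after replacing it by another row
    gives zero.  As the other rows are the translates of [sigma], this says
    that [omega * g_i + g_(i - mu) + g_(i + mu) = 0] for [0 <= i < n], where
    [g] vanishes outside [0, n] ([coef_producing_poly_rec]).  The recurrence
    splits along residue classes modulo [mu], and on the class of [a < mu] it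
    is the one that defines [r_k], so [g_(a + mu k) = g_a r_k(omega)] as long
    as the equations for the smaller indices of the class are available
    ([coef_producing_poly_residue]).

    For [n = mu s - 1], the class of [mu - 1] is the only one that misses its
    last equation (at [i = n]); it provides the announced coefficients.  For
    any other class, the last equation reads [g_a r_s(omega) = 0].  Hence
    [g_a = 0] if [r_s(omega) <> 0].  If [r_s(omega) = 0] and [mu >= 2], then
    the sequence equal to [r_k(omega)] at [mu k] and to [0] elsewhere gives a
    linear relation between the rows of the producing matrix other than the
    first, so that [G = 0] ([producing_poly_eq0]). *)

Section ProducingPolynomialCoefficients.

Variables (R : comNzRingType) (omega : R) (mu : nat).
Hypothesis mu_gt0 : (0 < mu)%N.

Local Notation r k := (rpoly R k).[omega].

Lemma horner_rpoly_rec (k : nat) :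
  omega * r k + (if (0 < k)%N then r k.-1 else 0) + r k.+1 = 0.
Proof.
have -> : (if (0 < k)%N then r k.-1 else 0) = (Defs.rshift R k).[omega].
  by case: k => [|k] //; rewrite horner0.
have := rpoly_rec R (ltn0Sn k) => /(congr1 (horner^~ omega)).
by rewrite subn1 !hornerD hornerM hornerX horner0 => <-; rewrite addrC addrA.
Qed.

Lemma sigmaN (k : int) : sigma omega mu (- k) = sigma omega mu k.
Proof. by rewrite /sigma oppr_eq0 abszN. Qed.

(** For [i < n], this is the product of [f] with the row of index [n - i] of
    the producing matrix, which is the translate of [sigma] by [i]. *)
Lemma sum_sigma (f : nat -> R) (n i : nat) : (i <= n)%N ->
  \sum_(j < n.+1) sigma omega mu (j%:Z - i%:Z) * f j =
  omega * f i + (if (mu <= i)%N then f (i - mu)%N else 0)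
  + (if (i + mu <= n)%N then f (i + mu)%N else 0).
Proof.
move=> le_in.
have pick1 (c : R) (p : nat) :
    \sum_(j < n.+1) (if j == p :> nat then c * f j else 0) =
    if (p <= n)%N then c * f p else 0.
  case: ifP => [le_pn|gt_pn].
    by rewrite -big_mkcond (big_pred1 (Ordinal (le_pn : (p < n.+1)%N))).
  by rewrite big1 // => j _; case: eqP => // jp; move: (ltn_ord j); lia.
transitivity (\sum_(j < n.+1)
    ((if j == i :> nat then omega * f j else 0)
     + (if (mu <= i)%N then if j == (i - mu)%N :> nat then 1 * f j else 0 else 0)
     + (if j == (i + mu)%N :> nat then 1 * f j else 0))).
  apply: eq_bigr => j _; rewrite /sigma.
  have -> : (j%:Z - i%:Z == 0) = (j == i :> nat) by lia.
  have -> : (`|j%:Z - i%:Z|%N == mu) =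
    ((mu <= i) && (j == i - mu :> nat) || (j == i + mu :> nat))%N by lia.
  case: (eqVneq (j : nat) i) => [->|_].
    have -> : (i == i + mu)%N = false by lia.
    case: leqP => le_mui; last by rewrite !addr0.
    have -> : (i == i - mu)%N = false by lia.
    by rewrite !addr0.
  case: (leqP mu i) => /= le_mui; last first.
    by case: ifP; rewrite !add0r ?mul0r.
  case: (eqVneq (j : nat) (i - mu)%N) => [->|_] /=.
    have -> : (i - mu == i + mu)%N = false by lia.
    by rewrite add0r addr0.
  by case: ifP; rewrite !add0r ?mul0r.
rewrite !big_split /= !pick1 le_in mul1r; congr (_ + _ + _).
case: ifP => _; last by rewrite big1.
by rewrite pick1 mul1r ifT //; lia.
Qed.

(** The producing matrix with its first row replaced by zeros.  The cofactors
    of the first row are unchanged, but all the entries are now scalars. *)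
Definition sigma_matrix (n : nat) : 'M[R]_n.+1 :=
  \matrix_(i, j) if i == 0 then 0 else sigma omega mu (i%:Z + j%:Z - n%:Z).

Lemma producing_poly_cofactor (n : nat) :
  producing_poly n omega mu =
  \poly_(j < n.+1) cofactor (sigma_matrix n) 0 (inord j).
Proof.
rewrite /producing_poly (expand_det_row _ 0) poly_def.
apply: eq_bigr => j _; rewrite mxE eqxx inord_val -mul_polyC mulrC.
congr (_ * _).
rewrite /cofactor rmorphM rmorphXn rmorphN rmorph1 -det_map_mx.
congr (_ * \det _); apply/matrixP => i k; rewrite !mxE.
by case: eqP => // /(congr1 val).
Qed.

Lemma size_producing_poly (n : nat) :
  (size (producing_poly n omega mu) <= n.+1)%N.
Proof. by rewrite producing_poly_cofactor size_poly. Qed.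

Lemma coef_producing_poly_rec (n i : nat) (G := producing_poly n omega mu) :
  (i < n)%N ->
  omega * G`_i + (if (mu <= i)%N then G`_(i - mu) else 0) + G`_(i + mu) = 0.
Proof.
move=> lt_in; rewrite {}/G; set G := producing_poly n omega mu.
have Gsupp : (if (i + mu <= n)%N then G`_(i + mu) else 0) = G`_(i + mu).
  case: leqP => // lt_n; rewrite nth_default //.
  exact: leq_trans (size_producing_poly n) _.
rewrite -Gsupp -(sum_sigma (fun k => G`_k) _ _ (ltnW lt_in)).
(* The equation at [i] comes from the row of index [n - i]. *)
have lt_row : (n - i < n.+1)%N by lia.
pose i' := Ordinal lt_row.
have i'_neq0 : i' != 0 by rewrite -val_eqE /=; lia.
have := congr1 (fun M : 'M_n.+1 => M i' 0) (mul_mx_adj (sigma_matrix n)).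
rewrite !mxE (negPf i'_neq0) mulr0n; apply: etrans.
apply: eq_bigr => j _; rewrite !mxE (negPf i'_neq0) /=.
congr (sigma _ _ _ * _); first by lia.
by rewrite /G producing_poly_cofactor coef_poly ltn_ord inord_val.
Qed.

Lemma coef_producing_poly_residue (n a k : nat)
    (G := producing_poly n omega mu) :
  (a < mu)%N -> ((0 < k)%N -> (a + mu * k.-1 < n)%N) ->
  G`_(a + mu * k) = G`_a * r k.
Proof.
move=> lt_a; rewrite {}/G; set G := producing_poly n omega mu.
elim/ltn_ind: k => -[_ _|k IHk /(_ isT) /= lt_n].
  by rewrite muln0 addn0 rpoly0 hornerE mulr1.
have := coef_producing_poly_rec _ _ lt_n.
rewrite -addnA -mulnSr -/G => /eqP; rewrite addrC addr_eq0 => /eqP ->.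
have := congr1 ( *%R G`_a) (horner_rpoly_rec k).
rewrite mulr0 mulrDr => /eqP; rewrite addrC addr_eq0 => /eqP ->.
congr (- _); rewrite mulrDr; congr (_ + _).
  rewrite IHk //; first by rewrite mulrCA.
  by case: (k) lt_n => //= j; nia.
case: k IHk lt_n => [|k] IHk lt_n /=.
  by rewrite muln0 addn0 leqNgt lt_a mulr0.
rewrite ifT; last by nia.
have -> : (a + mu * k.+1 - mu = a + mu * k)%N by nia.
rewrite IHk //; by case: (k) lt_n => //= j; nia.
Qed.

(** When [r_s(omega) = 0], the rows of index [n - mu k], [0 <= k < s], satisfy
    a linear relation with coefficients [r_k(omega)]; as [mu > 1], the first
    row is not one of them. *)
Lemma producing_poly_eq0 (s : nat) : (1 < mu)%N -> (0 < s)%N -> r s = 0 ->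
  producing_poly (mu * s - 1) omega mu = 0.
Proof.
move=> mu_gt1 s_gt0 rs0; set n := (mu * s - 1)%N.
pose f (i : nat) : R := if (mu %| i)%N then r (i %/ mu) else 0.
have f_rec i : omega * f i + (if (mu <= i)%N then f (i - mu)%N else 0)
    + f (i + mu)%N = 0.
  rewrite /f dvdn_addl // divnDr // divnn mu_gt0 addn1.
  case: (leqP mu i) => [le_mui|lt_imu].
    rewrite dvdn_subl // divnBr // divnn mu_gt0 subn1.
    case: ifP => _; last by rewrite mulr0 !addr0.
    by rewrite -(horner_rpoly_rec (i %/ mu)) divn_gt0 // le_mui.
  rewrite divn_small //; case: ifP => _; last by rewrite mulr0 !addr0.
  exact: horner_rpoly_rec 0.
have f_n : f n = 0.
  by rewrite /f dvdn_subr ?dvdn_mulr ?muln_gt0 ?mu_gt0 // dvdn1 gtn_eqF.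
have f_gt i : (n < i <= n + mu)%N -> f i = 0.
  rewrite /f; case: ifP => // /dvdnP[q ->] bnd; rewrite mulnK //.
  by have -> : q = s by rewrite /n in bnd; nia.
have relation : \row_(i < n.+1) (f (n - i)%N)%:P
    *m producing_matrix omega mu n = 0.
  apply/rowP => j; rewrite !mxE.
  transitivity ((\sum_(i < n.+1) sigma omega mu (i%:Z - j%:Z) * f i)%:P).
    rewrite rmorph_sum (reindex_inj rev_ord_inj); apply: eq_bigr => i _ /=.
    rewrite !mxE /= !subSS subKn ?leq_ord //.
    case: eqP => [/(congr1 val)/= | _].
      move=> ni0; have -> : (i : nat) = n by have := leq_ord i; lia.
      by rewrite f_n mulr0 mul0r.
    rewrite rmorphM mulrC /= -sigmaN; congr ((sigma _ _ _)%:P * _).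
    by have := leq_ord i; lia.
  (* [sum_sigma] drops the term [f (j + mu)] when [j + mu > n]; it is zero
     because [mu s] is the only multiple of [mu] in the range of [f_gt]. *)
  rewrite sum_sigma ?leq_ord //; congr (_%:P).
  apply: etrans (f_rec j); congr (_ + _); case: (leqP (j + mu) n) => // lt_n.
  by rewrite f_gt // lt_n leq_add2r leq_ord.
(* The last row has coefficient [r_0 = 1] in the relation, so multiplying by
   the adjugate gives [G * 1 = 0]. *)
have := congr1 (fun M => (M *m \adj (producing_matrix omega mu n)) 0 ord_max)
  relation.
rewrite -mulmxA mul_mx_adj mul_mx_scalar mul0mx !mxE subnn.
by rewrite /f dvdn0 div0n rpoly0 hornerE mulr1.
Qed.

End ProducingPolynomialCoefficients.

(** Outside the residue class of [mu - 1], all coefficients vanish. *)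
Lemma coef_producing_poly_eq0 (R : idomainType) (omega : R) (mu s a k : nat) :
  (0 < s)%N -> (a < mu.-1)%N -> (k < s)%N ->
  (producing_poly (mu * s - 1) omega mu)`_(a + mu * k) = 0.
Proof.
move=> s_gt0 lt_a lt_ks; have mu_gt0 : (0 < mu)%N by lia.
set n := (mu * s - 1)%N.
have a_lt : (a < mu)%N by lia.
have [rs0|rs_neq0] := eqVneq (rpoly R s).[omega] 0.
  by rewrite producing_poly_eq0 ?coef0 //; lia.
(* At index [a + mu s > n] the coefficient is zero, so [g_a r_s(omega) = 0]. *)
have := coef_producing_poly_residue _ omega _ mu_gt0 n a s a_lt.
rewrite nth_default; last first.
  by apply: leq_trans (size_producing_poly _ _ _ _) _; rewrite /n; nia.
move=> /(_ _)/esym/eqP; rewrite mulf_eq0 (negPf rs_neq0) orbF => ga0.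
rewrite coef_producing_poly_residue //; last first.
  by rewrite /n; case: (k) lt_ks => //= j; nia.
by rewrite (eqP (ga0 _)) ?mul0r // /n; case: (s) s_gt0 => //= j; nia.
Qed.

Theorem theorem2 (R : realType) (n mu s : nat) (omega : R)
    (hmu : (1 <= mu)%N) (hs : (2 <= s)%N) (hn : n = (mu * s - 1)%N) :
  let G := producing_poly n omega mu in
  [/\ forall k : nat, (1 <= k <= s)%N ->
        G`_(mu * k - 1) = G`_(mu - 1) * (rpoly R (k - 1)).[omega],
      forall m : nat, (m <= n)%N ->
        (forall k : nat, (1 <= k <= s)%N -> m <> (mu * k - 1)%N) ->
        G`_m = 0
    & G = G`_(mu - 1) *: ('X^(mu - 1) * (rsum (s - 1) omega \Po 'X^mu))].
Proof.
set G := producing_poly n omega mu => /=.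
have on_class k : (1 <= k <= s)%N ->
    G`_(mu * k - 1) = G`_(mu - 1) * (rpoly R (k - 1)).[omega].
  case: k => // k /= lt_ks.
  have -> : (mu * k.+1 - 1 = mu - 1 + mu * k)%N by nia.
  rewrite (subn1 k.+1) /= coef_producing_poly_residue //; first by lia.
  by rewrite hn; case: (k) lt_ks => //= j; nia.
have off_class m : (m <= n)%N ->
    (forall k : nat, (1 <= k <= s)%N -> m <> (mu * k - 1)%N) -> G`_m = 0.
  move=> le_mn m_off; rewrite (divn_eq m mu) addnC mulnC /G hn.
  have lt_q : (m %/ mu < s)%N by rewrite ltn_divLR //; nia.
  have lt_mod := ltn_pmod m hmu.
  apply: coef_producing_poly_eq0 => //; first by lia.
  have := m_off (m %/ mu).+1; have := divn_eq m mu; nia.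
split=> //; apply/polyP => m.
rewrite coefZ coefXnM coef_comp_poly_Xn // /rsum coef_poly.
case: (leqP m n) => [le_mn|lt_nm]; last first.
  rewrite nth_default; last exact: leq_trans (size_producing_poly _ _ _ _) _.
  case: ifP => _; first by rewrite mulr0.
  case: ifP => [/dvdnP[q m_eq]|_]; last by rewrite mulr0.
  by rewrite m_eq mulnK // ifF ?mulr0 //; nia.
case: (ltnP m (mu - 1)) => [lt_m|le_m].
  by rewrite mulr0 off_class // => k; nia.
case: ifP => [/dvdnP[q m_eq]|ndvd].
  have m_def : m = (mu * q.+1 - 1)%N by nia.
  have lt_qs : (q < s)%N by nia.
  by rewrite m_eq mulnK // ifT ?m_def ?on_class ?(subn1 q.+1) //; lia.
rewrite mulr0 off_class // => k k_le m_eq; move: ndvd.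
have -> : (m - (mu - 1) = k.-1 * mu)%N by nia.
by rewrite dvdn_mull.
Qed.
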